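(* Let $N\in\mathbb N$ and let $m,n,s,t$ be nonnegative integers with $m+t\le N$ and $n+s\le N$. Then $$\int_{\mathbb{R}^2} f_{m,n}(z,\bar z;\beta)\,\overline{f_{s,t}(z,\bar z;\beta)}\,d\nu(\theta;N)\,d\mu(r^2;\beta)=\zeta_{m\wedge n}(|m-n|+\beta)\,\delta_{m,s}\,\delta_{n,t},$$ where $z=re^{i\theta}$ and $d\mu(r;\beta)=r^{\beta}d\mu(r)$. If $N=\infty$, the same identity holds for all nonnegative integers $m,n,s,t$.
   Context: For $N\in\mathbb N\cup\{\infty\}$, $\nu(\theta;N)$ is a probability measure on the circle $\mathbb T=\{e^{i\theta}: 0\le\theta\le 2\pi\}$ satisfying $\int_{\mathbb T}e^{i(m-n)\theta}d\nu(\theta;N)=\delta_{m,n}$ for $m,n=0,1,\dots,N$ (for all nonnegative integers $m,n$ if $N=\infty$). $\mu$ is a positive Borel measure on $[0,\infty)$, and for every real $\alpha\ge0$, $\{\phi_n(r;\alpha)\}_{n\ge0}$ is a system of polynomials, $\phi_n(\cdot;\alpha)$ of exact degree $n$, with $\int_0^\infty\phi_m(r;\alpha)\phi_n(r;\alpha)r^\alpha d\mu(r)=\zeta_n(\alpha)\delta_{m,n}$, where $\zeta_n(\alpha)>0$, and $\mu$ does not depend on $\alpha$. Write $\phi_n(r;\alpha)=\sum_{j=0}^n c_j(n,\alpha)r^{n-j}$ with $c_j(n,\alpha)\in\mathbb R$. For $\beta\ge0$ and nonnegative integers $m,n$ define $f_{m,n}(z_1,z_2;\beta)=z_1^{m-n}\phi_n(z_1z_2;m-n+\beta)$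 if $m\ge n$, and $f_{m,n}(z_1,z_2;\beta)=f_{n,m}(z_2,z_1;\beta)$ if $m<n$. Here $m\wedge n=\min\{m,n\}$. The integral of $F(z)$ against $d\nu(\theta;N)\,d\mu(r^2;\beta)$ means $\int_0^\infty\int_{\mathbb T}F(\sqrt{x}\,e^{i\theta})\,d\nu(\theta;N)\,x^\beta d\mu(x)$. *)

(* Defs.v *)
From HB Require Import structures.
From mathcomp Require Export all_boot all_order all_algebra.
From mathcomp Require Export all_classical all_reals all_analysis.
From mathcomp.real_closed Require Export complex.

Set Implicit Arguments.
Unset Strict Implicit.
Unset Printing Implicit Defensive.

Import Order.TTheory GRing.Theory Num.Theory.
Import numFieldNormedType.Exports.

Local Open Scope classical_set_scope.
Local Open Scope ring_scope.
Local Open Scope complex_scope.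

(* MathComp-Analysis integrates real-valued functions only, so complex-valued
   ones are integrated componentwise.  Rintegral is total: it is meaningful
   only together with integrability. *)
Definition cintegrable d (T : measurableType d) (R : realType)
    (mu : {measure set T -> \bar R}) (D : set T) (F : T -> R[i]) : Prop :=
  mu.-integrable D (fun x => (complex.Re (F x))%:E) /\
  mu.-integrable D (fun x => (complex.Im (F x))%:E).

Definition cintegral d (T : measurableType d) (R : realType)
    (mu : {measure set T -> \bar R}) (D : set T) (F : T -> R[i]) : R[i] :=
  (\int[mu]_(x in D) complex.Re (F x)) +i* (\int[mu]_(x in D) complex.Im (F x)).

Definition expi (R : realType) (theta : R) : R[i] := cos theta +i* sin theta.

(* N : option nat stands for an element of {0, 1, 2, ...} together with
   infinity, the latter being None. *)
Definition le_ext (k : nat) (N : option nat) : bool :=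
  if N is Some N' then (k <= N')%N else true.

(* A probability measure on the circle { e^(i theta) : 0 <= theta <= 2 pi } is
   given in the angular coordinate theta; only functions of e^(i theta) are ever
   integrated against it. *)
Definition circle_orthonormal (R : realType) (N : option nat)
    (nu : probability (measurableTypeR R) R) : Prop :=
  nu `[0, 2 * pi]%classic = 1%E /\
  forall m n : nat, le_ext m N -> le_ext n N ->
    cintegral nu `[0, 2 * pi]%classic (fun theta => expi ((m%:R - n%:R) * theta))
      = (m == n)%:R.

(* phi n alpha is the polynomial phi_n(r; alpha) and zeta n alpha is
   zeta_n(alpha). *)
Definition radial_orthogonal (R : realType)
    (mu : {measure set (measurableTypeR R) -> \bar R})
    (phi : nat -> R -> {poly R}) (zeta : nat -> R -> R) : Prop :=
  mu `]-oo, 0[%classic = 0%E /\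
  forall alpha : R, 0 <= alpha ->
    [/\ forall n : nat, size (phi n alpha) = n.+1,
        forall n : nat, 0 < zeta n alpha
      & forall m n : nat,
          mu.-integrable `[0, +oo[%classic (fun r =>
            ((phi m alpha).[r] * (phi n alpha).[r] * r `^ alpha)%:E) /\
          \int[mu]_(r in `[0, +oo[%classic)
            ((phi m alpha).[r] * (phi n alpha).[r] * r `^ alpha)
            = zeta n alpha * (m == n)%:R].

(* The formula defining f_{m,n} in the case n <= m. *)
Definition zpoly_ge (R : realType) (phi : nat -> R -> {poly R}) (m n : nat)
    (beta : R) (z1 z2 : R[i]) : R[i] :=
  z1 ^+ (m - n) *
  (map_poly (real_complex R) (phi n (m%:R - n%:R + beta))).[z1 * z2].

Definition zpoly (R : realType) (phi : nat -> R -> {poly R}) (m n : nat)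
    (beta : R) (z1 z2 : R[i]) : R[i] :=
  if (n <= m)%N then zpoly_ge phi m n beta z1 z2
  else zpoly_ge phi n m beta z2 z1.

Definition angular_integral (R : realType)
    (nu : probability (measurableTypeR R) R) (F : R[i] -> R[i]) (x : R) : R[i] :=
  cintegral nu `[0, 2 * pi]%classic (fun theta => F ((Num.sqrt x)%:C * expi theta)).

(* The integral of F(z) against d nu(theta; N) d mu(r^2; beta), z = r e^(i theta),
   in the variable x = r^2. *)
Definition polar_integral (R : realType)
    (nu : probability (measurableTypeR R) R)
    (mu : {measure set (measurableTypeR R) -> \bar R}) (beta : R)
    (F : R[i] -> R[i]) : R[i] :=
  cintegral mu `[0, +oo[%classic (fun x => angular_integral nu F x * (x `^ beta)%:C).

(* Both integrals in polar_integral exist. *)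
Definition polar_integrable (R : realType)
    (nu : probability (measurableTypeR R) R)
    (mu : {measure set (measurableTypeR R) -> \bar R}) (beta : R)
    (F : R[i] -> R[i]) : Prop :=
  (forall x : R, 0 <= x ->
     cintegrable nu `[0, 2 * pi]%classic
       (fun theta => F ((Num.sqrt x)%:C * expi theta))) /\
  cintegrable mu `[0, +oo[%classic (fun x => angular_integral nu F x * (x `^ beta)%:C).

(* Main.v *)
From mathcomp Require Import ring lra zify.
Require Import Defs.
Import Order.TTheory GRing.Theory Num.Theory.
Import numFieldNormedType.Exports.
Local Open Scope classical_set_scope.
Local Open Scope ring_scope.
Local Open Scope complex_scope.

Set Implicit Arguments.
Unset Strict Implicit.
Unset Printing Implicit Defensive.

(** In polar coordinates [z = sqrt x * e^(i theta)] the polynomial [f_{m,n}]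
    separates: since [z * conj z = x], it is a real function of [x], namely
    [sqrt x ^ |m - n|] times the radial polynomial [phi_{min(m,n)}] of parameter
    [|m - n| + beta], multiplied by [e^(i (m - n) theta)] ([zpoly_polar]).
    Hence [f_{m,n} * conj f_{s,t}] is a real function of [x] multiplied by
    [e^(i ((m + t) - (n + s)) theta)].

    The bounds on [m + t] and [n + s] are exactly what lets orthonormality on
    the circle apply to that exponential: the angular integral vanishes unless
    [m + t = n + s] ([angular_integral_zpoly]).  When [m + t = n + s], that is
    [m - n = s - t], both radial polynomials carry the same parameter
    [alpha = |m - n| + beta], and the two factors [sqrt x ^ |m - n|] combine
    with the weight [x ^ beta] into [x ^ alpha] ([zpoly_radius_powR]).  What
    remains is the orthogonality of [phi_j] and [phi_k], with parameter [alpha],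
    for [j = min(m, n)] and [k = min(s, t)].  The difference and the minimum
    determine a pair of naturals, so the two Kronecker symbols obtained are
    those of the claim. *)

(** * The unit circle *)

Lemma expi0 (R : realType) : expi (0 : R) = 1.
Proof. by rewrite /expi cos0 sin0. Qed.

Lemma expiD (R : realType) (a b : R) : expi (a + b) = expi a * expi b.
Proof. by rewrite /expi cosD sinD addrC; congr (_ +i* _); rewrite addrC. Qed.

Lemma expiX (R : realType) (a : R) (k : nat) : expi a ^+ k = expi (k%:R * a).
Proof.
elim: k => [|k IHk]; first by rewrite mul0r expi0.
by rewrite exprS IHk -expiD mulrS mulrDl mul1r.
Qed.

Lemma expi_conj (R : realType) (a : R) : conjc (expi a) = expi (- a).
Proof. by rewrite /expi cosN sinN. Qed.

Lemma expi_mul_conj (R : realType) (a : R) : expi a * conjc (expi a) = 1.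
Proof. by rewrite expi_conj -expiD subrr expi0. Qed.

Lemma conjcM (R : realType) (z w : R[i]) :
  conjc (z * w) = conjc z * conjc w.
Proof. exact: rmorphM. Qed.

(** * Integrals of complex-valued functions *)

Lemma eq_cintegral d (T : measurableType d) (R : realType)
    (mu : {measure set T -> \bar R}) (D : set T) (F G : T -> R[i]) :
  {in D, F =1 G} -> cintegral mu D F = cintegral mu D G.
Proof.
by move=> FG; congr (_ +i* _); apply: eq_Rintegral => x /FG ->.
Qed.

Lemma eq_cintegrable d (T : measurableType d) (R : realType)
    (mu : {measure set T -> \bar R}) (D : set T) (F G : T -> R[i]) :
  measurable D -> {in D, F =1 G} -> cintegrable mu D F -> cintegrable mu D G.
Proof.
move=> mD FG [ReF ImF].
by split; [apply: eq_integrable ReF|apply: eq_integrable ImF] => // x /FG ->.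
Qed.

Lemma cintegrable_real d (T : measurableType d) (R : realType)
    (mu : {measure set T -> \bar R}) (D : set T) (g : T -> R) :
  measurable D -> mu.-integrable D (fun x => (g x)%:E) ->
  cintegrable mu D (fun x => (g x)%:C).
Proof. by move=> mD gi; split => //=; exact: integrable0. Qed.

Lemma cintegral_real d (T : measurableType d) (R : realType)
    (mu : {measure set T -> \bar R}) (D : set T) (g : T -> R) :
  cintegral mu D (fun x => (g x)%:C) = (\int[mu]_(x in D) g x)%:C.
Proof. by rewrite /cintegral /= /Rintegral integral0. Qed.

Lemma cintegrable_real_scale d (T : measurableType d) (R : realType)
    (mu : {measure set T -> \bar R}) (D : set T) (a : R) (F : T -> R[i]) :
  measurable D -> cintegrable mu D F ->
  cintegrable mu D (fun x => a%:C * F x).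
Proof.
move=> mD [ReF ImF]; split.
  apply: eq_integrable (integrableZl mD a ReF) => // x _.
  by rewrite -EFinM; case: (F x) => b c /=; rewrite mul0r subr0.
apply: eq_integrable (integrableZl mD a ImF) => // x _.
by rewrite -EFinM; case: (F x) => b c /=; rewrite mul0r addr0.
Qed.

Lemma cintegral_real_scale d (T : measurableType d) (R : realType)
    (mu : {measure set T -> \bar R}) (D : set T) (a : R) (F : T -> R[i]) :
  measurable D -> cintegrable mu D F ->
  cintegral mu D (fun x => a%:C * F x) = a%:C * cintegral mu D F.
Proof.
move=> mD [ReF ImF]; rewrite /cintegral /= [RHS]/GRing.mul /=.
rewrite !mul0r subr0 addr0 -!RintegralZl //.
by congr (_ +i* _); apply: eq_Rintegral => x _; case: (F x) => b c /=;
  rewrite mul0r ?subr0 ?addr0.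
Qed.

(** A probability measure is finite, and [cos] and [sin] are bounded. *)
Lemma cintegrable_expi (R : realType) (nu : probability (measurableTypeR R) R)
    (D : set (measurableTypeR R)) (k : R) :
  measurable D -> cintegrable nu D (fun theta => expi (k * theta)).
Proof.
move=> mD.
have nuD : (nu D < +oo)%E.
  by rewrite (le_lt_trans (probability_le1 nu mD)) // ltry.
have int_comp (f : R -> R) : continuous f -> (forall x, `|f x| <= 1) ->
    nu.-integrable D (fun theta => (f (k * theta))%:E).
  move=> cf f1; apply: measurable_bounded_integrable => //.
    apply: measurableT_comp; last exact: measurable_realfun.mulrl_measurable.
    exact: measurable_realfun.continuous_measurable_fun.
  exists 1; split=> // y y1 x Dx /=; exact: le_trans (f1 _) (ltW y1).
by split; apply: int_comp; [exact: continuous_cos|exact: cos_max|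
  exact: continuous_sin|exact: sin_max].
Qed.

(** * Separation of variables *)

(** The factor of [f_{m,n}] that depends on [x = r^2] only. *)
Definition zpoly_radius (R : realType) (phi : nat -> R -> {poly R}) (beta : R)
    (m n : nat) (x : R) : R :=
  Num.sqrt x ^+ `|m - n|%N *
  (phi (minn m n) (`|m%:R - n%:R| + beta)).[x].

Lemma zpoly_ge_polar (R : realType) (phi : nat -> R -> {poly R}) (beta : R)
    (m n : nat) (x : R) (u : R[i]) :
  0 <= x -> u * conjc u = 1 -> (n <= m)%N ->
  let z := (Num.sqrt x)%:C * u in
  zpoly_ge phi m n beta z (conjc z) =
  (zpoly_radius phi beta m n x)%:C * u ^+ (m - n).
Proof.
move=> x0 u1 nm z; rewrite {}/z /zpoly_ge /zpoly_radius.
have -> : (Num.sqrt x)%:C * u * conjc ((Num.sqrt x)%:C * u) = x%:C.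
  by rewrite conjcM conjc_real mulrACA u1 mulr1 -rmorphM -expr2 sqr_sqrtr.
rewrite horner_map exprMn rmorphM rmorphXn /= distnEl // (minn_idPr nm).
by rewrite ger0_norm ?subr_ge0 ?ler_nat // mulrAC.
Qed.

(** For [m < n] the roles of [z] and [conj z] are exchanged, which amounts to
    replacing [theta] by [- theta]; this makes the phase [(m - n) theta] in both
    cases. *)
Lemma zpoly_polar (R : realType) (phi : nat -> R -> {poly R}) (beta : R)
    (m n : nat) (x theta : R) : 0 <= x ->
  let z := (Num.sqrt x)%:C * expi theta in
  zpoly phi m n beta z (conjc z) =
  (zpoly_radius phi beta m n x)%:C * expi ((m%:R - n%:R) * theta).
Proof.
move=> x0 z; rewrite {}/z /zpoly; case: leqP => [nm|/ltnW mn].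
  by rewrite zpoly_ge_polar ?expi_mul_conj // expiX natrB.
have -> : (Num.sqrt x)%:C * expi theta =
    conjc ((Num.sqrt x)%:C * expi (- theta)).
  by rewrite conjcM conjc_real expi_conj opprK.
rewrite conjcK zpoly_ge_polar ?expi_mul_conj // expiX natrB //.
rewrite /zpoly_radius minnC distnC distrC; congr (_ * expi _).
by ring.
Qed.

Lemma zpoly_mul_conj_polar (R : realType) (phi : nat -> R -> {poly R})
    (beta : R) (m n s t : nat) (x theta : R) : 0 <= x ->
  let z := (Num.sqrt x)%:C * expi theta in
  zpoly phi m n beta z (conjc z) * conjc (zpoly phi s t beta z (conjc z)) =
  (zpoly_radius phi beta m n x * zpoly_radius phi beta s t x)%:C *
  expi (((m + t)%:R - (n + s)%:R) * theta).
Proof.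
move=> x0 z; rewrite {}/z !zpoly_polar // conjcM conjc_real.
rewrite expi_conj mulrACA -expiD [in RHS]rmorphM; congr (_ * expi _).
by ring.
Qed.

Lemma angular_integral_zpoly (R : realType) (N : option nat)
    (nu : probability (measurableTypeR R) R) (phi : nat -> R -> {poly R})
    (beta : R) (m n s t : nat) (x : R) :
  circle_orthonormal N nu -> le_ext (m + t) N -> le_ext (n + s) N -> 0 <= x ->
  angular_integral nu (fun z => zpoly phi m n beta z (conjc z) *
    conjc (zpoly phi s t beta z (conjc z))) x =
  (zpoly_radius phi beta m n x * zpoly_radius phi beta s t x *
   (m + t == n + s)%N%:R)%:C.
Proof.
move=> [_ nuE] mtN nsN x0; rewrite /angular_integral.
under eq_cintegral => theta _ do rewrite zpoly_mul_conj_polar //.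
rewrite cintegral_real_scale //; last exact: cintegrable_expi.
by rewrite nuE //; case: eqP => _; rewrite ?(mulr1, mulr0).
Qed.

(** * The radial weight *)

(** The identity also holds at [x = 0], where [powRD] fails in general, because
    [0 `^ 0 = 1] and the exponents are nonnegative. *)
Lemma exprn_mul_powR (R : realType) (x b : R) (k : nat) :
  0 <= x -> 0 <= b -> x ^+ k * x `^ b = x `^ (k%:R + b).
Proof.
move=> x0 b0; case: k => [|k]; first by rewrite expr0 mul1r add0r.
rewrite powRD ?powR_mulrn //.
by rewrite paddr_eq0 // pnatr_eq0.
Qed.

(** On the diagonal [m - n = s - t] the square roots pair up, and the angular
    momentum [|m - n|] is absorbed by the parameter of the radial weight. *)
Lemma zpoly_radius_powR (R : realType) (phi : nat -> R -> {poly R}) (beta : R)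
    (m n s t : nat) (x : R) :
  (m + t = n + s)%N -> 0 <= x -> 0 <= beta ->
  zpoly_radius phi beta m n x * zpoly_radius phi beta s t x * x `^ beta =
  (phi (minn m n) (`|m%:R - n%:R| + beta)).[x] *
  (phi (minn s t) (`|m%:R - n%:R| + beta)).[x] *
  x `^ (`|m%:R - n%:R| + beta).
Proof.
move=> mtns x0 beta0; rewrite /zpoly_radius.
have alphaE : `|s%:R - t%:R| = `|m%:R - n%:R| :> R.
  have : m%:R + t%:R = n%:R + s%:R :> R by rewrite -!natrD mtns.
  by move=> e; congr `|_|; lra.
have distE i j : `|i%:R - j%:R| = `|i - j|%N%:R :> R.
  by rewrite natr_absz intr_norm rmorphB.
have dE : `|s - t|%N = `|m - n|%N.
  by apply/eqP; rewrite -(eqr_nat R) -!distE alphaE.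
rewrite alphaE dE distE -exprn_mul_powR // -[in x ^+ _](sqr_sqrtr x0).
rewrite -exprM mul2n -addnn exprD.
by ring.
Qed.

(** * Orthogonality *)

Theorem theorem2p1 (R : realType) (N : option nat)
    (nu : probability (measurableTypeR R) R)
    (mu : {measure set (measurableTypeR R) -> \bar R})
    (phi : nat -> R -> {poly R}) (zeta : nat -> R -> R) (beta : R)
    (m n s t : nat) :
  circle_orthonormal N nu ->
  radial_orthogonal mu phi zeta ->
  0 <= beta ->
  le_ext (m + t) N -> le_ext (n + s) N ->
  polar_integrable nu mu beta
    (fun z => zpoly phi m n beta z (conjc z) * conjc (zpoly phi s t beta z (conjc z))) /\
  polar_integral nu mu beta
    (fun z => zpoly phi m n beta z (conjc z) * conjc (zpoly phi s t beta z (conjc z)))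
  = (zeta (minn m n) (`|m%:R - n%:R| + beta))%:C * (m == s)%:R * (n == t)%:R.
Proof.
move=> nuN [_ muE] beta0 mtN nsN; rewrite /polar_integrable /polar_integral.
set F := fun z : R[i] => zpoly phi m n beta z _ * _.
pose alpha : R := `|m%:R - n%:R| + beta.
pose g x :=
  (phi (minn m n) alpha).[x] * (phi (minn s t) alpha).[x] * x `^ alpha.
have alpha0 : 0 <= alpha by rewrite addr_ge0.
have [_ _ /(_ (minn m n) (minn s t))[g_int gE]] := muE alpha alpha0.
(* The Kronecker factor makes this hold off the diagonal m + t = n + s as well,
   where g is not the radial part of the integrand. *)
have radialE : {in `[0, +oo[%classic, forall x,
    ((m + t == n + s)%N%:R * g x)%:C = angular_integral nu F x * (x `^ beta)%:C}.
  move=> x /set_mem /=; rewrite in_itv /= andbT => x0.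
  rewrite (angular_integral_zpoly _ _ nuN) // -rmorphM.
  have [e|_] := eqVneq (m + t)%N (n + s)%N; last by rewrite mulr0 !mul0r.
  by rewrite mulr1 mul1r zpoly_radius_powR.
have radial_int : mu.-integrable `[0, +oo[%classic
    (fun x => ((m + t == n + s)%N%:R * g x)%:E).
  exact: integrableZl g_int.
split; first split.
- move=> x x0.
  have expi_int := cintegrable_expi nu ((m + t)%:R - (n + s)%:R)
    (measurable_itv `[0, 2 * pi]).
  apply: eq_cintegrable (cintegrable_real_scale _ _ expi_int) => // theta _.
  by rewrite /F zpoly_mul_conj_polar.
- by apply: eq_cintegrable (cintegrable_real _ radial_int) => //; exact: radialE.
transitivity (cintegral mu `[0, +oo[
    (fun x => ((m + t == n + s)%N%:R * g x)%:C)).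
  by apply: eq_cintegral => x /radialE.
rewrite cintegral_real RintegralZl // gE -/alpha.
have [->|ms] := eqVneq m s; last first.
  rewrite mulr0 mul0r.
  have [mtns|] := eqVneq (m + t)%N (n + s)%N; last by rewrite mul0r.
  (* Equal differences and equal minima would force m = s. *)
  have [min_eq|] := eqVneq (minn m n) (minn s t); last by rewrite !mulr0.
  by move/eqP: ms; lia.
rewrite mulr1 [(n + s)%N]addnC eqn_add2l [t == n]eq_sym.
have [->|_] := eqVneq n t; last by rewrite mul0r mulr0.
by rewrite eqxx !mulr1 mul1r.
Qed.
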